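(* Let $p$ and $\alpha$ be real numbers such that either $p\ge 2$ and $1\le \alpha\le 1+\frac1p$, or $1<p\le \frac43$ and $1+\frac1p\le\alpha\le 2$. Then for every complex sequence $(a_n)_{n\ge1}$ with $\sum_{n=1}^\infty |a_n|^p<\infty$, $$\sum_{n=1}^{\infty}\left|\frac{1}{\sum_{i=1}^n i^{\alpha-1}}\sum_{i=1}^n i^{\alpha-1}a_i\right|^p\le\left(\frac{\alpha p}{\alpha p-1}\right)^p\sum_{n=1}^\infty|a_n|^p.$$ *)

(* Defs.v *)
From mathcomp Require Import all_boot all_order all_algebra.
From mathcomp Require Import all_classical all_reals all_analysis.
From mathcomp Require Import complex.

Set Implicit Arguments.
Unset Strict Implicit.
Unset Printing Implicit Defensive.

Import Order.TTheory GRing.Theory Num.Theory.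

Local Open Scope ring_scope.
Local Open Scope complex_scope.

(* Sequences (a_n)_{n >= 1} are encoded as functions on nat whose value at 0
   is never used. *)
Definition weighted_mean (R : realType) (alpha : R) (a : nat -> R[i])
    (n : nat) : R[i] :=
  (\sum_(1 <= i < n.+1) (i%:R `^ (alpha - 1))%:C * a i) /
  (\sum_(1 <= i < n.+1) i%:R `^ (alpha - 1))%:C.

(* Main.v *)
(* Write lam_n = n^(alpha - 1), L_n = lam_1 + ... + lam_n, s_n = L_n / lam_n,
   kap = 1 / (alpha p), and let A_n be the weighted means of b_n = |a_n|.
   Suppose that
     s_{n+1} - kap <= s_n^p (s_n - kap)^(1-p).                           (1)
   Then convexity of x^p, applied to A_{N+1} = (m A_N + b_{N+1}) / (m + 1) with
   m = L_N / lam_{N+1}, shows by induction that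
     sum_{n <= N} A_n^p + m / (1 - kap) * A_N^p
       <= (1 - kap)^(-p) sum_{n <= N} b_n^p,
   and (1 - kap)^(-p) is the constant of the theorem.
   For (1), put r = alpha - 1 and t_n = alpha s_n. Expanding the right-hand side
   to second order reduces (1) to
     r <= t_n (1 - (n / (n + 1))^r) + d / t_n,   d = (p - 1) / (2 p).
   By Bernoulli's inequality t_n >= n + r, and the right-hand side increases
   in t_n from there on, so only t_n = n + r matters; that case is elementary
   as soon as d >= 1/4 (when p >= 2) or d >= (1 - r) / 2 (when r >= 1/p). *)

Require Import Defs.
From mathcomp Require Import all_boot all_order all_algebra.
From mathcomp Require Import all_classical all_reals all_analysis.
From mathcomp Require Import complex ring lra.

Import Order.TTheory GRing.Theory Num.Theory.
Import ComplexField.Normc.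

Local Open Scope ring_scope.
Local Open Scope complex_scope.

(** * Elementary inequalities for powers, logarithm and exponential *)

Lemma powR_invl {R : realType} (x a : R) : 0 <= x -> x^-1 `^ a = (x `^ a)^-1.
Proof. by move=> x0; rewrite -powR_inv1// powRAC powR_inv1// powR_ge0. Qed.

(** Jensen's inequality with weights [m / (m + k)] and [k / (m + k)], multiplied by [m + k]. *)
Lemma powR_convex2 {R : realType} (p m k x y : R) :
  1 <= p -> 0 <= m -> 0 < k -> 0 <= x -> 0 <= y ->
  (m * x + k * y) `^ p * (m + k) `^ (1 - p) <= m * x `^ p + k * y `^ p.
Proof.
move=> p1 m0 k0 x0 y0; have mk0 : 0 < m + k by lra.
have t01 : 0 <= m / (m + k) <= 1.
  by rewrite divr_ge0 ?ler_pdivrMr //=; lra.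
have := convex_powR p1 (Itv01 (andP t01).1 (andP t01).2) (x := x) (y := y).
rewrite !inE/= !in_itv/= !andbT => /(_ x0 y0).
rewrite convRE [X in X `^ _]convRE /unstable.onem/=.
have -> : m / (m + k) * x + (1 - m / (m + k)) * y =
  (m * x + k * y) / (m + k) by field; lra.
rewrite powRM ?invr_ge0 ?addr_ge0 ?mulr_ge0 ?(ltW k0) // => h.
have -> : (m + k) `^ (1 - p) = (m + k) * (m + k)^-1 `^ p.
  rewrite powRD; last by rewrite (gt_eqF mk0) implybT.
  by rewrite (powRr1 (ltW mk0)) powRN (powR_invl _ _ (ltW mk0)).
have := ler_wpM2l (ltW mk0) h.
set X := x `^ p; set Y := y `^ p.
have -> : (m + k) * (m / (m + k) * X + (1 - m / (m + k)) * Y) = m * X + k * Y.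
  by field; lra.
by rewrite mulrCA.
Qed.

(** With [z] the mean of [y] and [1] for the weights [r] and [1 - r], apply [ln u <= u - 1] at
    [y / z] and [1 / z]: the weighted right-hand sides cancel. *)
Lemma powR_Bernoulli {R : realType} (y r : R) : 0 < y -> 0 <= r <= 1 ->
  y `^ r <= 1 + r * (y - 1).
Proof.
move=> y0 /andP[r0 r1]; set z := 1 + r * (y - 1).
have z0 : 0 < z.
  have -> : z = (1 - r) + r * y by rewrite /z; ring.
  have [->|rn0] := eqVneq r 0; first by lra.
  have : 0 < r * y by rewrite mulr_gt0// lt_neqAle eq_sym rn0.
  by lra.
rewrite -ler_ln ?posrE ?powR_gt0// ln_powR.
have ln_le (u : R) : 0 < u -> ln u <= u - 1.
  by move=> u0; rewrite -{1}(subrK 1 u) addrC le_ln1Dx//; lra.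
have h1 := ln_le _ (divr_gt0 y0 z0).
have h2 := ln_le _ (divr_gt0 ltr01 z0).
rewrite ln_div ?posrE// in h1; rewrite ln_div ?posrE// ln1 in h2.
have h3 := lerD (ler_wpM2l r0 h1) (ler_wpM2l (_ : 0 <= 1 - r) h2).
have {h3} := h3 ltac:(lra).
have -> : r * (y / z - 1) + (1 - r) * (1 / z - 1) = 0.
  by rewrite /z; field; rewrite -/z; lra.
by lra.
Qed.

(** The difference vanishes at [1] and has derivative [(1 - x^-1) ^+ 2 / 2]. *)
Lemma ln_le_half_subV {R : realType} (y : R) : 1 <= y -> ln y <= (y - y^-1) / 2.
Proof.
move=> y1; pose f (x : R) : R := (x - x^-1) / 2 - ln x.
have df (x : R) : 0 < x -> is_derive x 1 f ((1 + x ^- 2) / 2 - x^-1).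
  move=> x0; have xn0 : x != 0 by rewrite gt_eqF.
  have dl := is_derive1_ln x0.
  have dV := is_deriveV xn0 (is_derive_id x 1).
  rewrite /f; apply: is_derive_eq.
  by rewrite /GRing.scale/=; field.
have : f 1 <= f y.
  apply: (@ger0_derive1_ndecr _ _ 1 y) => //.
  - move=> x; rewrite in_itv/= => /andP[x1 _].
    by have [] := df x (lt_trans ltr01 x1).
  - move=> x; rewrite in_itv/= => /andP[x1 _].
    have h := df x (lt_trans ltr01 x1).
    rewrite derive1E derive_val.
    have -> : (1 + x ^- 2) / 2 - x^-1 = (1 - x^-1) ^+ 2 / 2.
      by field; lra.
    by rewrite divr_ge0 ?sqr_ge0.
  - apply: derivable_within_continuous => x; rewrite in_itv/= => /andP[x1 _].
    by have [] := df x (lt_le_trans ltr01 x1).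
by rewrite /f ln1 invr1; lra.
Qed.

Lemma ln_subV_ge {R : realType} (x : R) : 0 <= x < 1 ->
  x + x ^+ 2 / 2 <= - ln (1 - x).
Proof.
move=> /andP[x0 x1]; pose f (u : R) : R := - ln (1 - u) - u - u ^+ 2 / 2.
have df (u : R) : u < 1 -> is_derive u 1 f ((1 - u)^-1 - 1 - u).
  move=> u1; have u0 : 0 < 1 - u by lra.
  have dl : is_derive (1 - u) 1 (@ln R) (1 - u)^-1 := is_derive1_ln u0.
  have dc : is_derive u 1 (fun v : R => 1 - v) (-1).
    by apply: is_derive_eq; ring.
  have dlc := @is_derive1_comp _ (@ln R) (fun v => 1 - v) u _ _ dl dc.
  rewrite /f; apply: is_derive_eq.
  by rewrite /GRing.scale/=; field; lra.
have : f 0 <= f x.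
  apply: (@ger0_derive1_ndecr _ _ 0 x) => //.
  - move=> u; rewrite in_itv/= => /andP[_ ux].
    by have [] := df u (lt_trans ux x1).
  - move=> u; rewrite in_itv/= => /andP[u0 ux].
    have h := df u (lt_trans ux x1).
    rewrite derive1E derive_val.
    have -> : (1 - u)^-1 - 1 - u = u ^+ 2 / (1 - u) by field; lra.
    by rewrite divr_ge0 ?sqr_ge0//; lra.
  - apply: derivable_within_continuous => u; rewrite in_itv/= => /andP[_ ux].
    by have [] := df u (le_lt_trans ux x1).
by rewrite /f !subr0 ln1; lra.
Qed.

Lemma expR_ge_quadratic {R : realType} (u : R) : 0 <= u ->
  1 + u + u ^+ 2 / 2 <= expR u.
Proof.
move=> u0; pose f (v : R) : R := expR v - (1 + v + v ^+ 2 / 2).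
have df (v : R) : is_derive v 1 f (expR v - (1 + v)).
  by rewrite /f; apply: is_derive_eq; rewrite /GRing.scale/=; field.
have : f 0 <= f u.
  apply: (@ger0_derive1_ndecr _ _ 0 u) => //.
  - move=> v _; have h := df v.
    by rewrite derive1E derive_val subr_ge0 expR_ge1Dx.
  - by apply: derivable_within_continuous => v _; have [] := df v.
by rewrite /f expR0; lra.
Qed.

(** Second-order lower bounds for [- ln (1 - x)] and for [expR] are composed; the terms
    [(p - 1) / 2] and [(p - 1) ^+ 2 / 2] in [x ^+ 2] add up to [p * (p - 1) / 2]. *)
Lemma powR_subV_ge_quadratic {R : realType} (p x : R) : 1 <= p -> 0 <= x < 1 ->
  1 + (p - 1) * x + p * (p - 1) / 2 * x ^+ 2 <= (1 - x) `^ (1 - p).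
Proof.
move=> p1 x01; have /andP[x0 x1] := x01.
have q0 : 0 <= p - 1 by lra.
rewrite /powR gt_eqF ?subr_gt0//.
have h := ln_subV_ge _ x01.
set u := (1 - p) * ln (1 - x).
have hu : (p - 1) * (x + x ^+ 2 / 2) <= u.
  by rewrite (_ : u = (p - 1) * - ln (1 - x)) ?ler_wpM2l// /u; ring.
have lu : (p - 1) * x <= u.
  by apply: le_trans hu; rewrite ler_wpM2l// lerDl divr_ge0 ?sqr_ge0.
have u0 : 0 <= u by apply: le_trans lu; rewrite mulr_ge0.
apply: le_trans (expR_ge_quadratic _ u0).
have : ((p - 1) * x) ^+ 2 <= u ^+ 2 by rewrite ler_sqr ?nnegrE// mulr_ge0.
by lra.
Qed.

(** * Induction on partial sums for general weights *)

(** The last hypothesis is (1), since [s_{n+1} = L n / lam n.+1 + 1]. The extra term in [A N] makes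
    the bound self-propagating. *)
Lemma mean_powR_partial_sum {R : realType} (p kap : R) (lam b : nat -> R)
    (L := fun n => \sum_(1 <= i < n.+1) lam i)
    (A := fun n => (\sum_(1 <= i < n.+1) lam i * b i) / L n) :
  1 <= p -> 0 <= kap < 1 ->
  (forall n, (0 < n)%N -> 0 < lam n) -> (forall n, 0 <= b n) ->
  (forall n, (0 < n)%N -> L n / lam n.+1 + (1 - kap) <=
     (L n / lam n) `^ p * (L n / lam n - kap) `^ (1 - p)) ->
  forall N, \sum_(1 <= n < N.+1) A n `^ p +
    L N / lam N.+1 / (1 - kap) * A N `^ p <=
    (1 - kap)^-1 `^ p * \sum_(1 <= n < N.+1) b n `^ p.
Proof.
move=> p1 /andP[kap0 kap1] lam0 b0 crit; set K := 1 - kap in crit *.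
have K0 : 0 < K by rewrite /K; lra.
have L0 n : 0 <= L n.
  by rewrite /L big_nat sumr_ge0// => i /andP[/lam0/ltW].
have A0 n : 0 <= A n.
  rewrite /A divr_ge0// big_nat sumr_ge0// => i /andP[i0 _].
  by rewrite mulr_ge0// ltW// lam0.
elim=> [|N IH]; first by rewrite /L !big_geq// !mul0r mulr0 addr0.
rewrite ![\sum_(1 <= n < N.+2) _]big_nat_recr//=.
set S := \sum_(1 <= n < N.+1) A n `^ p in IH *.
set T := \sum_(1 <= n < N.+1) b n `^ p in IH *.
have l1 : 0 < lam N.+1 by exact: lam0.
set m := L N / lam N.+1 in IH *; set m' := L N.+1 / lam N.+2.
have m0 : 0 <= m by rewrite divr_ge0// ltW.
have LS : L N.+1 = L N + lam N.+1 by rewrite /L big_nat_recr.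
have LSm : L N.+1 / lam N.+1 = m + 1 by rewrite LS /m mulrDl divff ?gt_eqF.
have AS : A N.+1 * (m + 1) = m * A N + K * (b N.+1 / K).
  have -> : K * (b N.+1 / K) = b N.+1 by field; lra.
  have LA : L N * A N = \sum_(1 <= i < N.+1) lam i * b i.
    (* [L N] vanishes only for [N = 0], where the sum is empty as well. *)
    rewrite /A mulrCA; have [L00|Ln0] := eqVneq (L N) 0; last first.
      by rewrite divff ?mulr1.
    rewrite L00 mul0r mulr0; apply/esym.
    case: N {IH S T l1 m m' m0 LS LSm} L00 => [|N] L00; first by rewrite big_geq.
    have : 0 < L N.+1 by rewrite /L big_nat_recr//= ltr_wpDl ?L0 ?lam0.
    by rewrite L00 ltxx.
  rewrite -LSm {1}/A big_nat_recr//= -LA /m.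
  have : 0 < L N.+1 by rewrite LS; have := L0 N; lra.
  by move=> LN0; field; rewrite !gt_eqF.
have := crit N.+1 isT; rewrite -/m' LSm => cr.
have mK : m + 1 - kap = m + K by rewrite /K; ring.
rewrite mK in cr.
have := powR_convex2 _ _ _ _ _ p1 m0 K0 (A0 N) (divr_ge0 (b0 N.+1) (ltW K0)).
have m10 : 0 <= m + 1 by lra.
rewrite -AS (powRM _ (A0 N.+1) m10) (powRM _ (b0 N.+1)) ?invr_ge0 ?(ltW K0)//.
set X := A N `^ p in IH *; set Y := b N.+1 `^ p.
set Z := A N.+1 `^ p; set Ki := K^-1 `^ p in IH *.
have Z0 : 0 <= Z by exact: powR_ge0.
(* By (1), [m' + K] is at most the factor of [Z] in the convexity bound. After division by [K], the
   term [m / K * X] is the one that [IH] controls. *)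
move=> h; have {h}h : Z * (m' + K) <= m * X + K * (Y * Ki).
  by apply: le_trans h; rewrite -mulrA ler_wpM2l.
have {h} : Z * (m' + K) / K <= (m * X + K * (Y * Ki)) / K.
  by rewrite ler_pM2r ?invr_gt0.
have -> : Z * (m' + K) / K = Z + m' / K * Z by field; lra.
have -> : (m * X + K * (Y * Ki)) / K = m / K * X + Y * Ki by field; lra.
by lra.
Qed.

(** * Criterion (1) for power weights *)

(* [1 - u ln y <= y^-u] applied at [u = q / 2] and squared: the plain [u = q]
   version is too weak at order [q^2]. *)
Lemma powR_le_rational {R : realType} (y q : R) : 1 <= y <= 2 -> 0 <= q <= 1 ->
  y `^ q * (y - q * (y - 1)) ^+ 2 <=
  y * (y - q * (y - 1) + q * (y - 1) ^+ 2 / 2).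
Proof.
move=> /andP[y1 y2] /andP[q0 q1]; have y0 : 0 < y by lra.
(* [Q / (4 * y)] is [1 - u ln y] at [u = q / 2], with [ln y] replaced by its upper bound
   [(y - y^-1) / 2]. *)
set Q := 4 * y - q * (y ^+ 2 - 1).
have Q0 : 0 < Q by rewrite /Q; nra.
have hQ : Q / (4 * y) = 1 - q / 2 * ((y - y^-1) / 2).
  by rewrite /Q; field; lra.
have h1 : y `^ (q / 2) * (Q / (4 * y)) <= 1.
  rewrite mulrC -ler_pdivlMr ?powR_gt0// div1r -powRN.
  apply: le_trans (_ : 1 + - (q / 2) * ln y <= _); last first.
    rewrite -ln_powR; apply: le_trans (expR_ge1Dx _) _.
    by rewrite lnK// posrE powR_gt0.
  rewrite hQ mulNr lerD2l lerN2 ler_wpM2l ?ln_le_half_subV//; lra.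
have h2 : y `^ q * Q ^+ 2 <= (4 * y) ^+ 2.
  have -> : q = q / 2 + q / 2 by lra.
  rewrite powRD; last by rewrite (gt_eqF y0) implybT.
  rewrite -expr2 -exprMn ler_sqr ?nnegrE.
  - by rewrite mulrA ler_pdivrMr ?mul1r// in h1; lra.
  - by rewrite mulr_ge0 ?powR_ge0// ltW.
  - by lra.
set P := y - q * (y - 1) + q * (y - 1) ^+ 2 / 2.
have P0 : 0 < P.
  have : 0 <= (1 - q) * (y - 1) by rewrite mulr_ge0; lra.
  have : 0 <= q * (y - 1) ^+ 2 by rewrite mulr_ge0 ?sqr_ge0.
  by rewrite /P; lra.
have h3 : 16 * y * (y - q * (y - 1)) ^+ 2 <= P * Q ^+ 2.
  rewrite -subr_ge0; pose x := y - 1.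
  (* Once [(q * x) ^+ 2] is factored out, the cofactor is affine and nonincreasing in [q], so its
     positivity need only be checked at [q = 1]. *)
  have -> : P * Q ^+ 2 - 16 * y * (y - q * (y - 1)) ^+ 2 =
    (q * x) ^+ 2 * ((1 + x) * (4 + 4 * x - 3 * x ^+ 2)
      - q * (x * (2 - x) * (2 + x) ^+ 2 / 2)).
    by rewrite /P /Q /x; field.
  have x0 : 0 <= x by rewrite /x; lra.
  have x1 : x <= 1 by rewrite /x; lra.
  apply: mulr_ge0; first exact: sqr_ge0.
  have e0 : 0 <= x * (2 - x) * (2 + x) ^+ 2 / 2.
    by rewrite !mulr_ge0 ?sqr_ge0//; lra.
  have : q * (x * (2 - x) * (2 + x) ^+ 2 / 2) <= x * (2 - x) * (2 + x) ^+ 2 / 2.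
    by rewrite ler_piMl.
  have : x * (2 - x) * (2 + x) ^+ 2 / 2 <= (1 + x) * (4 + 4 * x - 3 * x ^+ 2).
    rewrite -subr_ge0.
    have -> : (1 + x) * (4 + 4 * x - 3 * x ^+ 2) -
      x * (2 - x) * (2 + x) ^+ 2 / 2 =
      3 + 2 * x + (1 + 2 * x) * (1 - x ^+ 2) + x ^+ 4 / 2 by field.
    have : 0 <= (1 + 2 * x) * (1 - x ^+ 2).
      by rewrite mulr_ge0 ?subr_ge0 ?expr_le1//; lra.
    by have : 0 <= x ^+ 4 by [exact: exprn_ge0]; lra.
  by lra.
have yq0 := powR_ge0 y q.
have := ler_wpM2l yq0 h3; have := ler_wpM2l (ltW P0) h2.
set W := y `^ q; set E := (y - _) ^+ 2.
move=> h4 h5; have : 16 * y * (W * E) <= 16 * y * (y * P) by lra.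
by rewrite ler_pM2l//; lra.
Qed.

(** This is the reduced form of (1) multiplied by [t], with [x] in the role of [n]. *)
Lemma growth_quadratic {R : realType} (r d x t : R) (v := (x / (x + 1)) `^ r) :
  0 <= r <= 1 -> 1 <= x -> x + r <= t -> 1 / 4 <= d \/ (1 - r) / 2 <= d ->
  r * t <= t ^+ 2 * (1 - v) + d.
Proof.
move=> r01 x1 xt hd; have /andP[r0 r1] := r01.
have x0 : 0 < x / (x + 1) by rewrite divr_gt0//; lra.
have v1 : r / (x + 1) <= 1 - v.
  have := powR_Bernoulli _ _ x0 r01; rewrite -/v.
  have -> : x / (x + 1) - 1 = - (x + 1)^-1 by field; lra.
  by lra.
set t0 := x + r in xt *.
(* Passing from [t0] to [t] adds [(t - t0) * ((1 - v) * (t + t0) - r)], which is nonnegative because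
   [1 - v >= r / (x + 1)] and [t + t0 >= x + 1]. *)
suff h0 : r * t0 <= t0 ^+ 2 * (1 - v) + d.
  have g : r <= (1 - v) * (t + t0).
    have : r / (x + 1) * (t + t0) <= (1 - v) * (t + t0).
      by rewrite ler_wpM2r//; move: xt; rewrite /t0; lra.
    apply: le_trans; rewrite mulrAC ler_pdivlMr; last by lra.
    by rewrite ler_wpM2l//; move: xt; rewrite /t0; lra.
  have : 0 <= (t - t0) * ((1 - v) * (t + t0) - r).
    by rewrite mulr_ge0 ?subr_ge0.
  by lra.
case: hd => hd.
(* Bernoulli suffices here: it loses at most [r * (1 - r) <= 1 / 4]. *)
- have : t0 ^+ 2 * (r / (x + 1)) <= t0 ^+ 2 * (1 - v).
    by rewrite ler_wpM2l ?sqr_ge0.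
  have -> : t0 ^+ 2 * (r / (x + 1)) = r * t0 - r * (1 - r) * (t0 / (x + 1)).
    by rewrite /t0; field; lra.
  have : r * (1 - r) * (t0 / (x + 1)) <= 1 / 4.
    have : r * (1 - r) * (t0 / (x + 1)) <= r * (1 - r).
      by rewrite ler_piMr ?mulr_ge0 ?subr_ge0// ler_pdivrMr /t0; lra.
    by have : 0 <= (r - 1 / 2) ^+ 2 by [exact: sqr_ge0]; lra.
  by lra.
- set q := 1 - r in hd *; pose y := (x + 1) / x.
  have y12 : 1 <= y <= 2.
    by rewrite /y ler_pdivlMr ?ler_pdivrMr; lra.
  have y0 : 0 < y by lra.
  have q01 : 0 <= q <= 1 by rewrite /q; lra.
  have := powR_le_rational _ _ y12 q01.
  have -> : y `^ q = y * v.
    rewrite /q powRB; last by rewrite (gt_eqF y0) implybT.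
    rewrite (powRr1 (ltW y0)).
    by rewrite -powR_invl ?(ltW y0)// invf_div.
  have -> : y - q * (y - 1) = t0 / x by rewrite /y /q /t0; field; lra.
  have -> : t0 / x + q * (y - 1) ^+ 2 / 2 = (t0 * x + q / 2) / x ^+ 2.
    by rewrite /y; field; lra.
  rewrite -mulrA (ler_pM2l y0).
  rewrite expr_div_n mulrA ler_pM2r ?invr_gt0 ?exprn_gt0//; last by lra.
  have -> : t0 * x = t0 ^+ 2 - r * t0 by rewrite /t0; ring.
  by lra.
Qed.

Lemma sum_powR_ge {R : realType} (r : R) n : 0 <= r <= 1 ->
  (n.+1%:R + r) * n.+1%:R `^ r <= (1 + r) * \sum_(1 <= i < n.+2) i%:R `^ r.
Proof.
move=> r01; elim: n => [|n IH]; first by rewrite big_nat1.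
rewrite big_nat_recr//= mulrDr; apply: le_trans (lerD IH (lexx _)).
have x1 : 1 <= n.+1%:R :> R by rewrite ler1n.
have -> : n.+2%:R = n.+1%:R + 1 :> R by rewrite -natr1.
set x : R := n.+1%:R in x1 *.
have x0 : 0 < x by lra.
have xx0 : 0 < (x + 1) / x by rewrite divr_gt0//; lra.
have := powR_Bernoulli _ _ xx0 r01.
have {2}-> : (x + 1) / x = 1 + x^-1 by field; lra.
rewrite (powRM _ _ (_ : 0 <= x^-1)) ?invr_ge0 ?(ltW x0)//; last by lra.
rewrite (powR_invl _ _ (ltW x0)) ler_pdivrMr ?powR_gt0// => h.
have := ler_wpM2l (ltW x0) h.
set X := x `^ r; set Y := (x + 1) `^ r.
have -> : x * ((1 + r * (1 + x^-1 - 1)) * X) = (x + r) * X by field; lra.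
by lra.
Qed.

Lemma powR_weights_criterion {R : realType} (p r : R) (lam := fun n => n%:R `^ r)
    (L := fun n => \sum_(1 <= i < n.+1) lam i) (kap := ((1 + r) * p)^-1) :
  1 < p -> 0 <= r <= 1 -> 2 <= p \/ p^-1 <= r ->
  forall n, (0 < n)%N -> L n / lam n.+1 + (1 - kap) <=
     (L n / lam n) `^ p * (L n / lam n - kap) `^ (1 - p).
Proof.
move=> p1 r01 hp [//|n] _; have /andP[r0 r1] := r01.
have := sum_powR_ge _ n r01; rewrite -/lam -/(L n.+1).
have x1 : 1 <= n.+1%:R :> R by rewrite ler1n.
have lam2 : lam n.+2 = (n.+1%:R + 1) `^ r by rewrite /lam -natr1.
have lam1 : lam n.+1 = n.+1%:R `^ r by [].
rewrite lam2 lam1; set x : R := n.+1%:R in x1 lam1 lam2 *.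
have x0 : 0 < x by lra.
have lx0 : 0 < x `^ r by rewrite powR_gt0.
have ly0 : 0 < (x + 1) `^ r by rewrite powR_gt0//; lra.
set s := L n.+1 / x `^ r; pose t := (1 + r) * s.
rewrite -ler_pdivlMr// -mulrA -/s -/t => xt.
pose v := (x / (x + 1)) `^ r.
have -> : L n.+1 / (x + 1) `^ r = s * v.
  rewrite /v powRM ?invr_ge0//; [|lra..].
  by rewrite powR_invl; [rewrite /s; field; rewrite !gt_eqF | lra].
have p0 : 0 < p by lra.
have pV1 : p^-1 < 1 by rewrite invf_lt1.
pose d := (1 - p^-1) / 2.
have hd : 1 / 4 <= d \/ (1 - r) / 2 <= d.
  case: hp => hp; [left|right]; rewrite /d; last by lra.
  have : p^-1 <= 2^-1 by rewrite lef_pV2 ?posrE.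
  by lra.
have t1 : 1 <= t by lra.
have s0 : 0 < s by rewrite -(pmulr_rgt0 s (_ : 0 < 1 + r)) -/t; lra.
have := growth_quadratic _ _ _ _ r01 x1 xt hd; rewrite -/v => gq.
pose z := kap / s.
have zE : z = (p * t)^-1 by rewrite /z /kap /t; field; rewrite !gt_eqF//; lra.
have z01 : 0 <= z < 1.
  have pt1 : 1 < p * t by apply: lt_le_trans p1 _; rewrite ler_peMr// ltW.
  by rewrite zE invr_ge0 invf_lt1; lra.
have -> : s - kap = s * (1 - z) by rewrite /z; field; rewrite gt_eqF.
have z10 : 0 <= 1 - z by lra.
rewrite (powRM _ (ltW s0) z10) mulrA -powRD; last by rewrite (gt_eqF s0) implybT.
rewrite (_ : p + (1 - p) = 1); last by ring.
rewrite (powRr1 (ltW s0)).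
have := powR_subV_ge_quadratic p z (ltW p1) z01.
rewrite -(ler_pM2l s0); apply: le_trans.
have a0 : 0 < 1 + r by lra.
(* Multiplying by [1 + r] expresses both sides through [t]; what remains is [gq] divided by [t]. *)
rewrite -(ler_pM2l a0) mulrA -/t zE.
have -> : (1 + r) * (s * v + (1 - kap)) = t * v + 1 + r - p^-1.
  by rewrite /t /kap; field; rewrite !gt_eqF.
have -> : t * (1 + (p - 1) * (p * t)^-1 + p * (p - 1) / 2 * (p * t)^-1 ^+ 2) =
   t + 1 - p^-1 + d / t.
  by rewrite /d; field; rewrite !gt_eqF//; lra.
have : r <= t * (1 - v) + d / t.
  have t0 : 0 < t by lra.
  rewrite -(ler_pM2r t0); apply: le_trans gq _.
  by rewrite mulrDl divfK ?gt_eqF// expr2 mulrAC.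
by lra.
Qed.

(** * Reduction to moduli and passage to the limit *)

Lemma normc_real {R : rcfType} (x : R) : 0 <= x -> normc x%:C = x.
Proof. by move=> x0; rewrite /normc/= expr0n addr0 sqrtr_sqr ger0_norm. Qed.

Lemma normc_sum {R : rcfType} (f : nat -> R[i]) m n :
  normc (\sum_(m <= i < n) f i) <= \sum_(m <= i < n) normc (f i).
Proof.
elim/big_ind2 : _ => [|x1 y1 x2 y2 h1 h2|//]; first by rewrite normc0.
exact: le_trans (le_normcD _ _) (lerD h1 h2).
Qed.

Lemma normc_weighted_mean_le {R : realType} (alpha : R) (a : nat -> R[i]) n :
  normc (weighted_mean alpha a n) <=
  (\sum_(1 <= i < n.+1) i%:R `^ (alpha - 1) * normc (a i)) /
  \sum_(1 <= i < n.+1) i%:R `^ (alpha - 1).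
Proof.
have L0 : 0 <= \sum_(1 <= i < n.+1) i%:R `^ (alpha - 1).
  by apply: sumr_ge0 => i _; exact: powR_ge0.
rewrite /weighted_mean normcM normcV normc_real// ler_wpM2r ?invr_ge0//.
apply: le_trans (normc_sum _ _ _) _; apply: ler_sum => i _.
by rewrite normcM normc_real ?powR_ge0.
Qed.

Theorem theorem1p1 (R : realType) (p alpha : R)
    (hp : (2 <= p /\ 1 <= alpha <= 1 + p^-1) \/
          (1 < p <= 4 / 3 /\ 1 + p^-1 <= alpha <= 2))
    (a : nat -> R[i])
    (ha : (\sum_(1 <= n <oo) (normc (a n) `^ p)%:E < +oo)%E) :
  (\sum_(1 <= n <oo) (normc (weighted_mean alpha a n) `^ p)%:E <=
   ((alpha * p / (alpha * p - 1)) `^ p)%:E *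
   \sum_(1 <= n <oo) (normc (a n) `^ p)%:E)%E.
Proof.
have p1 : 1 < p.
  by case: hp => -[]; lra.
have p0 : 0 < p by lra.
have pV0 : 0 < p^-1 by rewrite invr_gt0; lra.
have pV1 : p^-1 < 1 by rewrite invf_lt1; lra.
set r := alpha - 1.
have r01 : 0 <= r <= 1 by rewrite /r; case: hp => -[]; lra.
have hr : 2 <= p \/ p^-1 <= r by rewrite /r; case: hp => -[]; lra.
have ap : 1 < alpha * p.
  apply: lt_le_trans p1 _; rewrite ler_peMl//; first by lra.
  by case: hp => -[]; lra.
pose kap := (alpha * p)^-1.
have kap01 : 0 <= kap < 1 by rewrite invr_ge0 invf_lt1; lra.
have KE : (1 - kap)^-1 = alpha * p / (alpha * p - 1).
  by rewrite /kap; field; rewrite !gt_eqF; lra.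
have aE : 1 + r = alpha by rewrite /r; ring.
have crit := powR_weights_criterion p r p1 r01 hr; rewrite aE in crit.
have lam0 n : (0 < n)%N -> 0 < n%:R `^ r :> R.
  by rewrite -(ltr0n R); exact: powR_gt0.
have normc_ge0 (z : R[i]) : 0 <= normc z by case: z => x y; exact: sqrtr_ge0.
have fin := mean_powR_partial_sum p kap _ (fun n => normc (a n))
  (ltW p1) kap01 lam0 (fun n => normc_ge0 (a n)) crit.
(* It is enough to bound every partial sum on the left by the full right-hand side. *)
apply: lime_le.
  by apply: is_cvg_nneseries => n _ _; rewrite lee_fin powR_ge0.
apply: nearW => -[|N].
  rewrite big_geq// mule_ge0 ?lee_fin ?powR_ge0//.
  by apply: nneseries_ge0 => n _ _; rewrite lee_fin powR_ge0.
apply: le_trans (_ : ((alpha * p / (alpha * p - 1)) `^ p)%:E *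
    \sum_(1 <= n < N.+1) (normc (a n) `^ p)%:E <= _)%E; last first.
  rewrite lee_wpmul2l ?lee_fin ?powR_ge0//.
  by apply: nneseries_lim_ge => n _ _; rewrite lee_fin powR_ge0.
rewrite !sumEFin -EFinM lee_fin -KE; apply: le_trans (fin N).
apply: le_trans (_ : \sum_(1 <= n < N.+1)
    ((\sum_(1 <= i < n.+1) i%:R `^ r * normc (a i)) /
    \sum_(1 <= i < n.+1) i%:R `^ r) `^ p <= _).
  apply: ler_sum => n _.
  apply: ge0_ler_powR; rewrite ?nnegrE ?normc_ge0//; first by lra.
    by apply: divr_ge0; apply: sumr_ge0 => i _; rewrite ?mulr_ge0 ?powR_ge0.
  exact: normc_weighted_mean_le.
(* The boundary term of the induction is nonnegative and is dropped. *)
rewrite lerDl mulr_ge0 ?powR_ge0// !divr_ge0 ?powR_ge0//; last by lra.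
by apply: sumr_ge0 => i _; exact: powR_ge0.
Qed.
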